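(* Let $\mathcal{B}$ be a reflexive real Banach space and let $\Omega\colon\mathcal{B}\to\mathbb{R}$ be admissible. Let $m\in\mathbb{N}$, $L_1,\dots,L_m\in\mathcal{B}^*$ and $y_1,\dots,y_m\in Y$ be such that the constraints $L_i(f)=y_i$ ($i=1,\dots,m$) can be satisfied. Consider the regularised interpolation problem $$(\mathrm{I})\qquad \min\{\Omega(f) : f\in\mathcal{B},\ L_i(f)=y_i\ \text{for all } i=1,\dots,m\}$$ and the minimal norm interpolation problem $$(\mathrm{N})\qquad \inf\{\|f\| : f\in\mathcal{B},\ L_i(f)=y_i\ \text{for all } i=1,\dots,m\}.$$ Then any representer theorem solution of $(\mathrm{I})$ is a solution of $(\mathrm{N})$. Moreover, for any solution of $(\mathrm{N})$ there exists a representer theorem solution of $(\mathrm{I})$ in the same face of the norm ball. In particular, if $\mathcal{B}$ is strictly convex, then $f_0\in\mathcal{B}$ is a representer theorem solution of $(\mathrm{I})$ if and only if it is a solution of $(\mathrm{N})$.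
   Context: For a real Banach space $\mathcal{B}$ with dual $\mathcal{B}^*$, the duality mapping $J\colon\mathcal{B}\to 2^{\mathcal{B}^*}$ is $$J(x)=\{L\in\mathcal{B}^* : L(x)=\|L\|\cdot\|x\|,\ \|L\|=\|x\|\},$$ so $J(0)=\{0\}$. Fix a set $Y\subseteq\mathbb{R}$ of possible outputs (typical examples: $Y=\mathbb{R}$ or $Y=\{-1,1\}$). A function $\Omega\colon\mathcal{B}\to\mathbb{R}$ is called admissible if for any $m\in\mathbb{N}$ and any data $L_1,\dots,L_m\in\mathcal{B}^*$, $y_1,\dots,y_m\in Y$ for which the interpolation constraints $L_i(f)=y_i$ can be satisfied, the problem of minimising $\Omega(f)$ over all $f\in\mathcal{B}$ with $L_i(f)=y_i$ for all $i$ admits a solution $f$ for which there exist $c_1,\dots,c_m\in\mathbb{R}$ with $\sum_{i=1}^m c_iL_i\in J(f)$. A representer theorem solution of $(\mathrm{I})$ is a solution $f_0$ of $(\mathrm{I})$ (i.e. $f_0$ satisfies the constraints and attains the minimum) for which there exist $c_1,\dots,c_m\in\mathbb{R}$ with $\sum_{i=1}^m c_iL_i\in J(f_0)$. A solution of $(\mathrm{N})$ is an $f_0$ satisfying the constraints and attaining the infimum. Faces: for $L\in\mathcal{B}^*$, the face exposed by $L$ is the set $\{g\in\mathcal{B} : L\in J(g)\}$; for $L\neq0$ this is the face of the ball of radius $\|L\|$ centred at $0$ on which $L$ attains its maximum over that ball, and for $L=0$ it is $\{0\}$. Two points are in the same face of the norm ball if some such exposed face contains both. *)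

(* Defs.v *)
From HB Require Import structures.
From mathcomp Require Import all_boot all_order all_algebra.
From mathcomp Require Import all_classical all_reals all_analysis.

Set Implicit Arguments.
Unset Strict Implicit.
Unset Printing Implicit Defensive.

Import Order.TTheory GRing.Theory Num.Theory.
Import numFieldNormedType.Exports.

Local Open Scope classical_set_scope.
Local Open Scope ring_scope.

Section dual_space.
Context {R : realType} (V : normedModType R).

Definition dual_pred : {pred V -> R^o} :=
  [pred f : V -> R^o | `[< linear f /\ continuous f >]].

Record dual := Dual { dual_fun :> V -> R^o; _ : dual_fun \in dual_pred }.

HB.instance Definition _ := [isSub for dual_fun].
HB.instance Definition _ := [Choice of dual by <:].

Lemma dualP (L : dual) : linear L /\ continuous L.
Proof. by apply/asboolP; exact: (valP L). Qed.

Lemma dual_submod_closed : submod_closed dual_pred.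
Proof.
split=> [|a f g /asboolP[lf cf] /asboolP[lg cg]]; apply/asboolP.
  split=> [b x y|x]; last exact: cst_continuous.
  by rewrite /GRing.zero/= scaler0 addr0.
split=> [b x y|x].
  rewrite !fctE lf lg !scalerDr addrACA; congr (_ + _ + (_ + _)).
  by rewrite !scalerA mulrC.
by apply: cvgD; [apply: cvgZl_tmp; exact: cf|exact: cg].
Qed.

HB.instance Definition _ :=
  GRing.isSubmodClosed.Build R (V -> R^o) dual_pred dual_submod_closed.
HB.instance Definition _ := [SubChoice_isSubLmodule of dual by <:].

Lemma dual_addE (L M : dual) x : (L + M) x = L x + M x.
Proof. by []. Qed.

Lemma dual_scaleE (a : R) (L : dual) x : (a *: L) x = a * L x.
Proof. by []. Qed.

HB.instance Definition _ (L : dual) :=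
  GRing.isLinear.Build R V R^o *:%R (dual_fun L) (dualP L).1.

Definition dual_norm (L : dual) : R :=
  sup [set `|L x| | x in [set x : V | `|x| <= 1]].

Lemma dual_has_sup (L : dual) :
  has_sup [set `|L x| | x in [set x : V | `|x| <= 1]].
Proof.
split; first by exists `|L 0|, 0 => //=; rewrite normr0.
have : bounded_near L (nbhs (0 : V)).
  exact/linear_bounded_continuous/(dualP L).2.
move=> /linear_boundedP/pinfty_ex_gt0[M M0 LM].
exists M => _ [x /= x1 <-]; apply: (le_trans (LM x)).
by rewrite ler_piMr// ltW.
Qed.

Lemma dual_norm_ub (L : dual) x : `|x| <= 1 -> `|L x| <= dual_norm L.
Proof. by move=> x1; apply: sup_upper_bound; [exact: dual_has_sup|exists x]. Qed.

Lemma dual_norm_ge0 (L : dual) : 0 <= dual_norm L.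
Proof. by apply: le_trans (@dual_norm_ub L 0 _); rewrite ?normr0. Qed.

Lemma dual_norm_le (L : dual) M :
  (forall x, `|x| <= 1 -> `|L x| <= M) -> dual_norm L <= M.
Proof.
move=> LM; apply: ge_sup; first exact: (dual_has_sup L).1.
by move=> _ [x x1 <-]; exact: LM.
Qed.

Lemma dual_norm_bound (L : dual) x : `|L x| <= dual_norm L * `|x|.
Proof.
have [->|x0] := eqVneq x 0; first by rewrite raddf0 !normr0 mulr0.
have nx : 0 < `|x| by rewrite normr_gt0.
have := @dual_norm_ub L (`|x|^-1 *: x).
rewrite linearZ/= !normrZ normfV normr_id mulVf ?gt_eqF// => /(_ (lexx _)).
by rewrite ler_pdivrMl// mulrC.
Qed.

Lemma dual_normD (L M : dual) : dual_norm (L + M) <= dual_norm L + dual_norm M.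
Proof.
apply: dual_norm_le => x x1; rewrite dual_addE (le_trans (ler_normD _ _))//.
by rewrite lerD// dual_norm_ub.
Qed.

Lemma dual_normZ (a : R) (L : dual) : dual_norm (a *: L) = `|a| * dual_norm L.
Proof.
have le_normZ b M : dual_norm (b *: M) <= `|b| * dual_norm M.
  apply: dual_norm_le => x x1.
  by rewrite dual_scaleE normrM ler_wpM2l// dual_norm_ub.
apply/eqP; rewrite eq_le le_normZ/=; have [->|a0] := eqVneq a 0.
  by rewrite normr0 mul0r dual_norm_ge0.
rewrite -ler_pdivlMl ?normr_gt0// -normfV.
by apply: le_trans (le_normZ _ _); rewrite scalerA mulVf// scale1r.
Qed.

Lemma dual_norm0_eq0 (L : dual) : dual_norm L = 0 -> L = 0.
Proof.
move=> L0; apply/val_inj/funext => x.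
by apply/normr0_eq0/le_anti; rewrite normr_ge0 andbT;
  have := dual_norm_bound L x; rewrite L0 mul0r.
Qed.

HB.instance Definition _ :=
  Lmodule_isNormed.Build R dual dual_normD dual_normZ dual_norm0_eq0.

Lemma dual_normE (L : dual) :
  `|L| = sup [set `|L x| | x in [set x : V | `|x| <= 1]].
Proof. by []. Qed.

End dual_space.

Section banach.
Context {R : realType} (B : completeNormedModType R).

(* The canonical embedding of B into its bidual is onto. *)
Definition reflexive_space : Prop :=
  forall Phi : dual (dual B), exists x : B, forall L : dual B, Phi L = L x.

Definition strictly_convex : Prop :=
  forall (x y : B) (t : R), `|x| = 1 -> `|y| = 1 -> x != y -> 0 < t < 1 ->
    `|t *: x + (1 - t) *: y| < 1.

Definition duality_map (x : B) : set (dual B) :=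
  [set L : dual B | L x = `|L| * `|x| /\ `|L| = `|x|].

Definition exposed_face (L : dual B) : set B := [set g | duality_map g L].

Definition same_face (f g : B) : Prop :=
  exists L : dual B, exposed_face L f /\ exposed_face L g.

End banach.

Section interpolation.
Context {R : realType} {B : completeNormedModType R}.

Definition interpolants m (L : 'I_m -> dual B) (y : 'I_m -> R) : set B :=
  [set f | forall i, L i f = y i].

Definition regularised_solution (Omega : B -> R) m (L : 'I_m -> dual B)
    (y : 'I_m -> R) : set B :=
  [set f0 | interpolants L y f0 /\
    forall f, interpolants L y f -> Omega f0 <= Omega f].

Definition representer_solution (Omega : B -> R) m (L : 'I_m -> dual B)
    (y : 'I_m -> R) : set B :=
  [set f0 | regularised_solution Omega L y f0 /\
    exists c : 'I_m -> R, duality_map f0 (\sum_(i < m) c i *: L i)].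

Definition min_norm_solution m (L : 'I_m -> dual B) (y : 'I_m -> R) : set B :=
  [set f0 | interpolants L y f0 /\
    `|f0| = inf [set `|f| | f in interpolants L y]].

(* At least one constraint is required: for m = 0 the condition would further
   force Omega to be minimal at 0. *)
Definition admissible (Y : set R) (Omega : B -> R) : Prop :=
  forall (m : nat) (L : 'I_m -> dual B) (y : 'I_m -> R),
    (0 < m)%N -> (forall i, Y (y i)) -> interpolants L y !=set0 ->
    representer_solution Omega L y !=set0.

End interpolation.

(* Main.v *)
(** If [M = \sum_i c i *: L i] is a norming functional of a representer theorem
    solution [f1], then [M] takes the same value [`|f1| ^+ 2 = `|M| * `|f1|] at
    every interpolant [f]. Hence [`|f1| <= `|f|], and when [f] also has minimal
    norm, [M] attains its norm at [f] as well, so that [f] lies in the face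
    exposed by [M]. In a strictly convex space a face is a single point. *)
Require Import Defs.
From HB Require Import structures.
From mathcomp Require Import all_boot all_order all_algebra.
From mathcomp Require Import all_classical all_reals all_analysis.
Import Order.TTheory GRing.Theory Num.Theory.
Import numFieldNormedType.Exports.
Local Open Scope classical_set_scope.
Local Open Scope ring_scope.

Section minimal_norm.
Set Implicit Arguments.
Unset Strict Implicit.
Context {R : realType} {B : completeNormedModType R}.

Lemma dual_sumE m (c : 'I_m -> R) (L : 'I_m -> dual B) (x : B) :
  (\sum_(i < m) c i *: L i) x = \sum_(i < m) c i * L i x.
Proof.
elim/big_ind2 : _ => // M a N b Ma Nb.
by rewrite dual_addE Ma Nb.
Qed.

Lemma sum_interpolants m (c : 'I_m -> R) (L : 'I_m -> dual B) (y : 'I_m -> R)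
    (f g : B) : interpolants L y f -> interpolants L y g ->
  (\sum_(i < m) c i *: L i) f = (\sum_(i < m) c i *: L i) g.
Proof.
by move=> Lf Lg; rewrite !dual_sumE; apply: eq_bigr => i _; rewrite Lf Lg.
Qed.

(** Comes from the chain [|f| * |f| = M f = M g <= |M| * |g| = |f| * |g|], divided by [|f|] when it
    is nonzero. *)
Lemma duality_map_norm_le (M : dual B) (f g : B) :
  duality_map f M -> M f = M g -> `|f| <= `|g|.
Proof.
move=> [Mf Mn] fg; have [f0|] := eqVneq `|f| 0; first by rewrite f0.
rewrite -normr_gt0 normr_id => f0; rewrite -(ler_pM2l f0) -{1}Mn -Mf fg -Mn.
exact: le_trans (ler_norm _) (dual_norm_bound _ _).
Qed.

(** Trades the infimum for a pointwise comparison. The two agree because the set of norms is bounded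
    below by 0 and contains [|f0|], so [inf] is a genuine infimum. *)
Lemma min_norm_solutionP m (L : 'I_m -> dual B) (y : 'I_m -> R) (f0 : B) :
  min_norm_solution L y f0 <->
  interpolants L y f0 /\ forall f, interpolants L y f -> `|f0| <= `|f|.
Proof.
have lb0 : has_lbound [set `|f| | f in interpolants L y].
  by exists 0 => _ [f _ <-].
split=> -[If0 min0]; split=> //.
  by move=> f If; rewrite min0; apply: ge_inf => //; exists f.
apply/le_anti/andP; split; last by apply: ge_inf => //; exists f0.
by apply: lb_le_inf => [|_ [f If <-]]; [exists `|f0|, f0|exact: min0].
Qed.

Lemma representer_min_norm (Omega : B -> R) m (L : 'I_m -> dual B)
    (y : 'I_m -> R) (f0 : B) :
  representer_solution Omega L y f0 -> min_norm_solution L y f0.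
Proof.
move=> [[If0 _] [c Jc]]; apply/min_norm_solutionP; split=> // f If.
by apply: duality_map_norm_le Jc _; exact: sum_interpolants If0 If.
Qed.

Lemma min_norm_same_face (Omega : B -> R) m (L : 'I_m -> dual B)
    (y : 'I_m -> R) (f0 f1 : B) :
  min_norm_solution L y f0 -> representer_solution Omega L y f1 ->
  same_face f0 f1.
Proof.
move=> [If0 min0] r1; have [_ min1] := representer_min_norm r1.
case: r1 => -[If1 _] [c [Mf1 Mn]].
have f01 : `|f0| = `|f1| by rewrite min0 min1.
exists (\sum_(i < m) c i *: L i); split; last by split.
(* Membership in the face depends on [f0] only through its norm and its value under the functional,
   both shared with [f1]. *)
by split; rewrite f01 // (sum_interpolants _ If0 If1).
Qed.

(** If [f] and [g] differed, their rescalings to the unit sphere would have a midpoint of norm less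
    than 1, yet [M] takes the value [|M|] there. *)
Lemma strictly_convex_same_face (f g : B) :
  strictly_convex B -> same_face f g -> f = g.
Proof.
move=> scB [M [[Mf nf] [Mg ng]]].
(* The points of the face have norm [|M|]: they vanish if [M] does, and otherwise can be divided by
   [|M|]. *)
have [M0|M0] := eqVneq `|M| 0.
  have /normr0_eq0 -> : `|f| = 0 by rewrite -nf.
  by have /normr0_eq0 -> : `|g| = 0 by rewrite -ng.
have Mgt0 : 0 < `|M| by rewrite lt_neqAle eq_sym M0 normr_ge0.
apply/eqP/negP => /negP fg.
have n1 (x : B) : `|M| = `|x| -> `| `|M|^-1 *: x| = 1.
  by move=> Mx; rewrite normrZ normfV normr_id -Mx mulVf.
have fgM : `|M|^-1 *: f != `|M|^-1 *: g.
  by apply: contra fg => /eqP /(scalerI (invr_neq0 M0)) ->.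
have h01 : 0 < (2^-1 : R) < 1 by rewrite invr_gt0 ltr0n invf_lt1 ?ltr1n.
have := scB _ _ _ (n1 _ nf) (n1 _ ng) fgM h01.
apply/negP; rewrite -leNgt -(ler_pM2l Mgt0) mulr1.
apply: le_trans (dual_norm_bound M _); apply: le_trans (ler_norm _).
rewrite linearD !linearZ /= Mf Mg -nf -ng /GRing.scale /= mulKf// -mulrDl.
by rewrite addrC subrK mul1r.
Qed.

End minimal_norm.

Theorem theorem4p2 (R : realType) (B : completeNormedModType R)
    (Y : set R) (Omega : B -> R) (m : nat) (L : 'I_m -> dual B)
    (y : 'I_m -> R) :
  reflexive_space B -> admissible Y Omega ->
  (0 < m)%N -> (forall i, Y (y i)) -> interpolants L y !=set0 ->
  [/\ forall f0, representer_solution Omega L y f0 -> min_norm_solution L y f0,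
      forall f0, min_norm_solution L y f0 ->
        exists f1, representer_solution Omega L y f1 /\ same_face f0 f1
    & strictly_convex B ->
      forall f0, representer_solution Omega L y f0 <-> min_norm_solution L y f0].
Proof.
move=> _ admO m0 Yy I0; have [f1 r1] := admO _ _ _ m0 Yy I0.
split=> [f0|f0 min0|scB f0]; first exact: representer_min_norm.
  by exists f1; split=> //; exact: min_norm_same_face min0 r1.
split=> [|min0]; first exact: representer_min_norm.
(* Here [f0] coincides with the solution [f1] supplied by admissibility. *)
by rewrite (strictly_convex_same_face scB (min_norm_same_face min0 r1)).
Qed.
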